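(* Let $m,n$ be positive integers. Every real tensor $\mathcal{A}$ of order $m$ and dimension $n$ can be expressed as the (entrywise) sum of a centrosymmetric real tensor and a skew centrosymmetric real tensor, both of order $m$ and dimension $n$.
   Context: Write $[n]=\{1,\dots,n\}$. A real tensor of order $m$ and dimension $n$ is an array $\mathcal{A}=(a_{i_1\cdots i_m})$ of reals with $i_1,\dots,i_m\in[n]$. It is centrosymmetric if $a_{i_1\cdots i_m}=a_{n-i_1+1,\dots,n-i_m+1}$ for all indices, and skew centrosymmetric if $a_{i_1\cdots i_m}=-a_{n-i_1+1,\dots,n-i_m+1}$ for all indices. *)

(* Defs.v *)
From mathcomp Require Import all_boot all_order all_algebra.
From mathcomp Require Import reals.

Set Implicit Arguments.
Unset Strict Implicit.
Unset Printing Implicit Defensive.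

Import GRing.Theory.
Local Open Scope ring_scope.

(* Entries are indexed by tuples (i_1, ..., i_m) of elements of 'I_n; the sum
   of tensors is the pointwise sum of finite functions. *)
Definition tensor (R : realType) (m n : nat) : Type :=
  {ffun m.-tuple 'I_n -> R}.

(* 'I_n is {0, ..., n-1}, so that i |-> n - i + 1 on {1, ..., n} becomes
   i |-> n - 1 - i, which is rev_ord. *)
Definition rev_index (m n : nat) (i : m.-tuple 'I_n) : m.-tuple 'I_n :=
  map_tuple (@rev_ord n) i.

Definition centrosymmetric (R : realType) (m n : nat) (A : tensor R m n) : Prop :=
  forall i : m.-tuple 'I_n, A i = A (rev_index i).

Definition skew_centrosymmetric (R : realType) (m n : nat) (A : tensor R m n) : Prop :=
  forall i : m.-tuple 'I_n, A i = - A (rev_index i).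

(* Main.v *)
(** Reversal of indices is an involution J, so A = (A + AJ)/2 + (A - AJ)/2
    splits A into its J-invariant and J-anti-invariant parts. *)

Require Import Defs.
From mathcomp Require Import all_boot all_order all_algebra.
From mathcomp Require Import reals.

Import GRing.Theory Num.Theory.
Local Open Scope ring_scope.

(** Since [rev_index] is an involution, replacing [i] by [rev_index i] swaps [A i] and
    [A (rev_index i)]: their half-sum is fixed and their half-difference changes sign. *)

Lemma rev_indexK (m n : nat) : involutive (@rev_index m n).
Proof.
by move=> i; apply: eq_from_tnth => k; rewrite !tnth_map rev_ordK.
Qed.

Theorem theorem3p7 (R : realType) (m n : nat) (hm : (0 < m)%N) (hn : (0 < n)%N)
    (A : tensor R m n) :
  exists B C : tensor R m n,
    [/\ centrosymmetric B, skew_centrosymmetric C & A = B + C].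
Proof.
exists [ffun i => (A i + A (rev_index i)) / 2].
exists [ffun i => (A i - A (rev_index i)) / 2].
split=> [i|i|]; first by rewrite !ffunE rev_indexK addrC.
  by rewrite !ffunE rev_indexK -mulNr opprB.
(* The reversed entries cancel, leaving [A i *+ 2 / 2]; halving undoes the doubling because 2 is
   nonzero in characteristic 0. *)
apply/ffunP => i; rewrite !ffunE -mulrDl addrACA subrr addr0 -mulr2n.
by rewrite -(mulr_natr (A i)) mulfK // pnatr_eq0.
Qed.
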